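(* Let $\Gamma$ be a graph and $k\ge0$. Then: (i) $\mathfrak I^-_k\Gamma=\langle\mathrm{mon}(\alpha):\alpha\in\mathrm{Fix}_k(\Gamma)\rangle$; more precisely, the nonzero minors of $\mathsf C^-_\Gamma$ are precisely the elements $\pm\mathrm{mon}(\alpha)$ for $\alpha\in\mathrm{Fix}(\Gamma)$. (ii) $\frac12\mathfrak I^+_k\Gamma=\langle\mathrm{mon}(\alpha):\alpha\in\mathrm{Odd}_k(\Gamma)\rangle$; more precisely, the nonzero minors of $\mathsf C^+_\Gamma$ are precisely the elements $\pm2^{\mathrm{odlen}(\alpha)}\mathrm{mon}(\alpha)$ for $\alpha\in\mathrm{Odd}(\Gamma)$.
   Context: $\Gamma=(V,E)$ is a finite graph (loops allowed, no parallel edges), with vertices ordered $v_1,\dots,v_n$ and adjacency $\sim$. $\mathsf C^\pm_\Gamma\in\mathrm{Mat}_{|E|\times n}(\mathbf Z[X_v:v\in V])$ has rows indexed by edges and columns by $1,\dots,n$: for an edge $e=\{v_i,v_j\}$ with $i\le j$, the entry in row $e$, column $k$ is $X_{v_i}$ if $k=j$, is $\pm X_{v_j}$ if $k=i$ and $i\neq j$, and is $0$ otherwise. $\mathfrak I^\pm_k\Gamma$ is the ideal of $\mathbf Z[X_V]$ generated by the $k\times k$ minors of $\mathsf C^\pm_\Gamma$, and $\frac12\mathfrak I^+_k\Gamma$ is the ideal of $\mathbf Z[\tfrac12][X_V]$ generated by $\mathfrak I^+_k\Gamma$. An animation of $\Gamma$ is a partial function $\alpha:V\dashrightarrow V$ with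 $v^\alpha\sim v$ for all $v\in\mathrm{Dom}(\alpha)$; its degree is $|\mathrm{Dom}(\alpha)|$, and $\mathrm{mon}(\alpha)=\prod_{v\in\mathrm{Dom}(\alpha)}X_{v^\alpha}$. A point $v$ is $\alpha$-periodic if $v^{\alpha^m}=v$ for some $m\ge1$; $\alpha$ permutes its periodic points, and $\mathrm{odlen}(\alpha)$ is the number of orbits of periodic points of odd length $>1$. $\mathrm{Fix}(\Gamma)$ is the set of animations all of whose periodic points are fixed points; $\mathrm{Odd}(\Gamma)$ the set of animations all of whose periodic points have odd period; subscript $k$ denotes degree $k$. *)

(* Defs.v *)
From HB Require Import structures.
From mathcomp Require Import all_boot all_order all_algebra.
From mathcomp Require Import mpoly.

Set Implicit Arguments.
Unset Strict Implicit.
Unset Printing Implicit Defensive.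

Import Order.TTheory GRing.Theory Num.Theory.
Local Open Scope ring_scope.

(* A rational number lies in Z[1/2] iff its reduced denominator is a power
   of 2; see [half_intP]. *)
Definition half_int : {pred rat} := fun x => 2%N.-nat `|denq x|%N.

Lemma half_intP (x : rat) :
  reflect (exists k : nat, x * 2 ^+ k \is a Num.int) (x \in half_int).
Proof.
apply: (iffP idP) => [/p_natP [k dx] | [k /intrP [m xm]]].
  exists k.
  have -> : 2 ^+ k = (denq x)%:~R :> rat.
    by rewrite -[denq x]absz_denq dx -pmulrn natrX.
  by rewrite -numqE intr_int.
have Exm : numq x * 2 ^+ k = m * denq x.
  apply: (@intr_inj rat); rewrite !rmorphM /= rmorphXn /= numqE -xm.
  by rewrite mulrAC.
have : (`|denq x| %| `|numq x| * 2 ^ k)%N.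
  have -> : (`|numq x| * 2 ^ k = `|m| * `|denq x|)%N.
    by have /(congr1 absz) := Exm; rewrite !abszM abszX.
  exact: dvdn_mull.
rewrite Gauss_dvdr; last by rewrite coprime_sym coprime_num_den.
by move=> dvd2; apply: pnat_dvd dvd2 _; rewrite pnatX pnat_id.
Qed.

Lemma half_int_subring : subring_closed half_int.
Proof.
split=> [|x y /half_intP [k kx] /half_intP [l ly]
         |x y /half_intP [k kx] /half_intP [l ly]].
- by apply/half_intP; exists 0%N; rewrite mulr1 rpred1.
- apply/half_intP; exists (k + l)%N; rewrite mulrBl exprD.
  rewrite mulrA [y * _]mulrCA [2 ^+ k * _]mulrC.
  by rewrite rpredB // rpredM // rpredX // rpred_nat.
- by apply/half_intP; exists (k + l)%N; rewrite exprD mulrACA rpredM.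
Qed.

HB.instance Definition _ :=
  GRing.isSubringClosed.Build rat half_int half_int_subring.

Record Zhalf := MkZhalf { Zhalf_val :> rat; _ : Zhalf_val \in half_int }.

HB.instance Definition _ := [isSub for Zhalf_val].
HB.instance Definition _ := [Choice of Zhalf by <:].
HB.instance Definition _ := [SubChoice_isSubComNzRing of Zhalf by <:].

Definition ideal_gen (R : comNzRingType) (S : R -> Prop) (x : R) : Prop :=
  exists (m : nat) (a g : 'I_m -> R),
    (forall i, S (g i)) /\ x = \sum_(i < m) a i * g i.

(* The vertex v_(i+1) is the ordinal i; a graph with loops allowed and without
   parallel edges is a symmetric relation [adj].  The edge {v_i, v_j}, i <= j,
   is encoded as the ordered pair (i, j). *)
Definition edges n (adj : rel 'I_n) : {set 'I_n * 'I_n} :=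
  [set p : 'I_n * 'I_n | (p.1 <= p.2)%N && adj p.1 p.2].

Definition incidence (s : bool) n (adj : rel 'I_n) :
    'M[{mpoly int[n]}]_(#|edges adj|, n) :=
  \matrix_(r, c)
    let: (i, j) := enum_val r in
    if c == j then 'X_i else if c == i then (-1) ^+ s * 'X_j else 0.

Definition Cplus n (adj : rel 'I_n) := incidence false adj.
Definition Cminus n (adj : rel 'I_n) := incidence true adj.

Definition is_minor (R : comNzRingType) p q (A : 'M[R]_(p, q)) (k : nat)
    (x : R) : Prop :=
  exists (f : 'I_k -> 'I_p) (g : 'I_k -> 'I_q),
    [/\ {homo f : a b / (a < b)%N}, {homo g : a b / (a < b)%N}
      & x = \det (mxsub f g A)].

Definition Iplus n (adj : rel 'I_n) k : {mpoly int[n]} -> Prop :=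
  ideal_gen (is_minor (Cplus adj) k).
Definition Iminus n (adj : rel 'I_n) k : {mpoly int[n]} -> Prop :=
  ideal_gen (is_minor (Cminus adj) k).

Definition half_Iplus n (adj : rel 'I_n) k : {mpoly Zhalf[n]} -> Prop :=
  ideal_gen (fun y : {mpoly Zhalf[n]} =>
    exists2 x : {mpoly int[n]}, Iplus adj k x & y = map_mpoly intr x).

(* [a v = None] means that v is outside the domain of the partial function. *)
Notation pfun n := {ffun 'I_n -> option 'I_n}.

Definition animation n (adj : rel 'I_n) (a : pfun n) : bool :=
  [forall v, if a v is Some w then adj w v else true].

Definition dom n (a : pfun n) : {set 'I_n} := [set v | a v != None].

Definition mon (R : comNzRingType) n (a : pfun n) : {mpoly R[n]} :=
  \prod_v (if a v is Some w then 'X_w else 1).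

(* a as a total map on V + {None}, None being absorbing; its m-th iterate maps
   Some v to Some v^(a^m), or to None when v^(a^m) is undefined. *)
Definition pmap_of n (a : pfun n) : option 'I_n -> option 'I_n := obind a.

(* v is reachable from v^a; see [periodicP]. *)
Definition periodic n (a : pfun n) (v : 'I_n) : bool :=
  fconnect (pmap_of a) (pmap_of a (Some v)) (Some v).

Lemma periodicP n (a : pfun n) v :
  reflect (exists2 m, (0 < m)%N & iter m (pmap_of a) (Some v) = Some v)
          (periodic a v).
Proof.
apply: (iffP idP) => [/iter_findex E | [[|m] // _ E]].
  by exists (findex (pmap_of a) (pmap_of a (Some v)) (Some v)).+1;
     rewrite // iterSr.
by rewrite /periodic -[X in fconnect _ _ X]E iterSr; exact: fconnect_iter.
Qed.

(* The period is the size of the forward orbit; see [periodP]. *)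
Definition period n (a : pfun n) (v : 'I_n) : nat :=
  order (pmap_of a) (Some v).

Lemma periodP n (a : pfun n) v : periodic a v ->
  [/\ (0 < period a v)%N, iter (period a v) (pmap_of a) (Some v) = Some v
    & forall m, (0 < m)%N -> iter m (pmap_of a) (Some v) = Some v ->
      (period a v <= m)%N].
Proof.
move=> v_per; split; first exact: order_gt0.
  exact/(orbitPcycle 2 4).
case=> // m _ Em; rewrite -(size_traject (pmap_of a) (Some v) m.+1).
apply: order_le_cycle; last by rewrite trajectS mem_head.
by rewrite trajectS /cycle rcons_path fpath_traject /= last_traject -iterS Em /=.
Qed.

Definition aorbit n (a : pfun n) (v : 'I_n) : {set 'I_n} :=
  [set w | fconnect (pmap_of a) (Some v) (Some w)].

Definition odlen n (a : pfun n) : nat :=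
  #|[set aorbit a v | v : 'I_n &
      [&& periodic a v, odd (period a v) & (1 < period a v)%N]]|.

Definition Fix n (adj : rel 'I_n) (k : nat) : {set pfun n} :=
  [set a | [&& animation adj a, #|dom a| == k &
      [forall v, periodic a v ==> (a v == Some v)]]].

Definition Odd n (adj : rel 'I_n) (k : nat) : {set pfun n} :=
  [set a | [&& animation adj a, #|dom a| == k &
      [forall v, periodic a v ==> odd (period a v)]]].

(* Main.v *)
Require Import Defs.
From HB Require Import structures.
From mathcomp Require Import all_boot all_order fingroup perm action all_algebra.
From mathcomp Require Import mpoly.

Set Implicit Arguments.
Unset Strict Implicit.
Unset Printing Implicit Defensive.

Import Order.TTheory GRing.Theory.
Local Open Scope ring_scope.

(* A nonzero term in the Leibniz expansion of a minor matches each chosen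
   column v with a chosen edge {v, v^a}, and so defines an animation a whose
   domain is the set of columns.  Reordering the rows accordingly and fixing
   their signs, the row of v becomes X_{v^a} e_v + z X_v e_{v^a}, where z = 1
   for C^+ and z = -1 for C^-, the second summand being absent when v^a = v or
   v^a is not a column.  The permutations t contributing to its determinant are
   those with v^t equal to v or v^a; such a t agrees with a on a union of
   nontrivial cycles of a and fixes everything else, and since on a cycle the
   products of the X_v and of the X_{v^a} coincide, its term is
   (-1)^t z^#{moved points} mon(a).  Summing over the sets of cycles gives
     mon(a) * prod_C (1 - (-z)^|C|),
   C running over the nontrivial cycles: the factors are 0 for z = -1, while for
   z = 1 they are 2 or 0 according to the parity of |C|. *)

(** * Cycles of a permutation and sums over unions of its cycles *)

Section Perm.
Variable T : finType.
Implicit Types (s t c : {perm T}) (S : {set {set T}}) (x y : T).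

Definition nontrivial_cycles s : {set {set T}} :=
  [set B in porbits s | (1 < #|B|)%N].

Definition moved s : {set T} := [set x | s x != x].

Lemma eq_porbit s t x :
  (forall y, y \in porbit s x -> t y = s y) -> porbit t x = porbit s x.
Proof.
move=> st.
have E m : (t ^+ m)%g x = (s ^+ m)%g x.
  elim: m => [|m IH]; first by rewrite !expg0.
  by rewrite !expgSr !permM IH st // mem_porbit.
by apply/setP=> y; apply/porbitP/porbitP=> -[m ->]; exists m.
Qed.

Lemma card_porbit_gt1 s x : (1 < #|porbit s x|)%N = (x \in moved s).
Proof.
rewrite inE; apply/idP/idP => [gt1|sx].
  apply: contraTneq gt1 => sx; rewrite -leqNgt.
  rewrite (_ : porbit s x = [set x]) ?cards1 //.
  apply/setP=> y; rewrite inE; apply/porbitP/eqP => [[m ->]|->].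
    by elim: m => [|m IH]; rewrite ?expg0 ?perm1 // expgSr permM IH.
  by exists 0%N; rewrite expg0 perm1.
have: [set x; s x] \subset porbit s x.
  by rewrite subUset !sub1set porbit_id -{1}(expg1 s) mem_porbit.
by move/subset_leq_card; rewrite cards2 eq_sym sx.
Qed.

Lemma partition_porbits s : partition (porbits s) [set: T].
Proof.
have /orbit_partition : [acts <[s]>%g, on [set: T] | 'P]
  by apply/actsP => x _ y; rewrite !inE.
under eq_imset do rewrite -porbitE.
rewrite /porbits; congr partition; apply/setP=> B.
by apply/imsetP/imsetP=> -[x _ ->]; exists x.
Qed.

Lemma cover_nontrivial_cycles s : cover (nontrivial_cycles s) = moved s.
Proof.
apply/setP=> x; apply/bigcupP/idP => [[B]|mx].
  rewrite inE => /andP[/imsetP[y _ ->] gt1] yx.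
  by rewrite -card_porbit_gt1 (eqP (_ : porbit s x == porbit s y)) ?eq_porbit_mem.
by exists (porbit s x); rewrite ?porbit_id // inE card_porbit_gt1 mx imset_f.
Qed.

Lemma card_moved s : #|moved s| = \sum_(B in nontrivial_cycles s) #|B|.
Proof.
have /and3P[_ tr _] := partition_porbits s.
have sub : nontrivial_cycles s \subset porbits s.
  by apply/subsetP=> B; rewrite inE => /andP[].
by rewrite -cover_nontrivial_cycles; apply/esym/eqP/(trivIsetS sub).
Qed.

(** The parity of [s] is that of [#|T|] plus the number of orbits, and [#|T|] is the sum of the
    orbit sizes. So each orbit contributes its size plus one, which is even for the trivial
    orbits. *)
Lemma sign_nontrivial_cycles (R : comNzRingType) s :
  (-1) ^+ s = \prod_(B in nontrivial_cycles s) (-1) ^+ #|B|.+1 :> R.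
Proof.
have -> : \prod_(B in nontrivial_cycles s) (-1) ^+ #|B|.+1 =
    \prod_(B in porbits s) (-1) ^+ #|B|.+1 :> R.
  rewrite [RHS](bigID (fun B : {set T} => (1 < #|B|)%N)) /= [X in _ * X]big1 ?mulr1.
    by apply: eq_bigl => B; rewrite inE.
  move=> B /andP[/imsetP[x _ ->]]; rewrite -leqNgt => le1.
  have /eqP -> : #|porbit s x| == 1%N by rewrite eqn_leq le1 lt0n card_porbit_neq0.
  by rewrite expr2 mulrNN mulr1.
rewrite -(big_morph _ (exprD _) (expr0 _)) -[RHS]signr_odd.
apply: (congr1 (fun b : bool => (-1) ^+ b)).
under eq_bigr do rewrite -addn1.
rewrite big_split /= sum1_card oddD.
by rewrite -(card_partition (partition_porbits s)) cardsT.
Qed.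

(** In this way the permutations selected in [sum_sub_cycles] are parametrised by sets of nontrivial
    cycles of [c]. *)
Definition keep c S x := if porbit c x \in S then c x else x.

Lemma porbit_perm1 c x : porbit c (c x) = porbit c x.
Proof. by rewrite -{2}(expg1 c) porbit_perm. Qed.

Lemma keep_inj c S : injective (keep c S).
Proof.
rewrite /keep => x y; case: ifP => xS; case: ifP => yS //; first exact: perm_inj.
  by move=> E; move: yS; rewrite -E porbit_perm1 xS.
by move=> E; move: xS; rewrite E porbit_perm1 yS.
Qed.

Definition keep_perm c S : {perm T} := perm (@keep_inj c S).

Lemma nontrivial_cycles_keep c S :
  nontrivial_cycles (keep_perm c S) = S :&: nontrivial_cycles c.
Proof.
have P x : porbit c x \in S -> porbit (keep_perm c S) x = porbit c x.
  move=> xS; apply: eq_porbit => y; rewrite -eq_porbit_mem => /eqP yx.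
  by rewrite permE /keep yx xS.
have M x : (x \in moved (keep_perm c S)) = (porbit c x \in S) && (x \in moved c).
  by rewrite !inE permE /keep; case: ifP; rewrite ?eqxx.
apply/setP=> B; rewrite !inE; apply/andP/and3P => [[/imsetP[x _ ->]]|[]].
  rewrite card_porbit_gt1 M => /andP[xS mx].
  by rewrite P // xS imset_f.
move=> BS /imsetP[x _ Bx]; subst B => gt1; split=> //.
by apply/imsetP; exists x => //; rewrite P.
Qed.

(** A permutation sends moved points to moved points, so [t] agrees with [c] along the whole
    [t]-orbit of a moved point, and that orbit is also a [c]-orbit. *)
Lemma keep_nontrivial_cycles c t :
  (forall x, t x = x \/ t x = c x) -> keep_perm c (nontrivial_cycles t) = t.
Proof.
move=> tc.
have M x : x \in moved t -> t x = c x.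
  by rewrite inE; case: (tc x) => // ->; rewrite eqxx.
have step x : x \in moved t -> t x \in moved t.
  by rewrite !inE; apply: contraNneq => /perm_inj ->.
have P x : x \in moved t -> porbit c x = porbit t x.
  move=> mx; apply: eq_porbit => y /porbitP[m ->]; apply/esym/M.
  elim: m => [|m IH]; first by rewrite expg0 perm1.
  by rewrite expgSr permM step.
apply/permP=> x; rewrite permE /keep; case: ifP => [|xN].
  rewrite inE => /andP[/imsetP[y _ xy] gt1]; apply/esym/M.
  have my: y \in moved t by rewrite -card_porbit_gt1 -xy.
  have: x \in porbit t y by rewrite -xy porbit_id.
  by rewrite -card_porbit_gt1 -eq_porbit_mem => /eqP ->; rewrite card_porbit_gt1.
apply/eqP; apply: contraFT xN; rewrite eq_sym => tx.
have mx : x \in moved t by rewrite inE.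
by rewrite P // inE imset_f // card_porbit_gt1.
Qed.

(* For fixed-point free [c] both sides are [\det (1 + z P_c)]. *)
Lemma sum_sub_cycles (R : comNzRingType) c (z : R) :
  \sum_(t : {perm T} | [forall x, (t x == x) || (t x == c x)])
     (-1) ^+ t * z ^+ #|moved t| =
  \prod_(B in nontrivial_cycles c) (1 - (- z) ^+ #|B|).
Proof.
rewrite (reindex_onto (keep_perm c) nontrivial_cycles) /=; last first.
  by move=> t /forallP tc; apply: keep_nontrivial_cycles => x;
    case/orP: (tc x) => /eqP ->; [left | right].
(* The condition left by the reindexing amounts to [S] being a subset of the cycles of [c]. Sign and
   power of [z] combine cycle by cycle, as [(-1) ^+ m.+1 * z ^+ m = - (- z) ^+ m]. *)
transitivity (\sum_(S : {set {set T}} | S \subset nontrivial_cycles c)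
    \prod_(B in S) - (- z) ^+ #|B|).
  apply: eq_big => [S|S /andP[_ /eqP ES]].
    rewrite nontrivial_cycles_keep; apply/andP/setIidPl => [[_ /eqP]//|->].
    split=> //; apply/forallP=> x; rewrite permE /keep.
    by case: ifP; rewrite eqxx ?orbT.
  rewrite sign_nontrivial_cycles card_moved ES.
  rewrite (big_morph _ (exprD z) (expr0 _)) -big_split /=.
  by apply: eq_bigr => B _; rewrite exprS mulN1r mulNr -exprNn.
rewrite [RHS]big_mkcond /=.
(* Distributivity yields a sum over all sets [S]; the value 0 off the cycles of [c] kills every [S]
   that is not a subset. *)
transitivity (\prod_B ((if B \in nontrivial_cycles c then - (- z) ^+ #|B| else 0) + 1)).
  rewrite bigA_distr /= [LHS]big_mkcond; apply: eq_bigr => S _.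
  rewrite -big_mkcond /=; case: ifPn => [/subsetP sub|/subsetPn[B BS BN]].
    by apply: eq_bigr => B /sub ->.
  by rewrite (bigD1 B) //= (negbTE BN) mul0r.
by apply: eq_bigr => B _; case: ifP; rewrite ?add0r // addrC.
Qed.

End Perm.

(** * Periodic points of a partial function *)

Section Periodic.
Variables (n : nat) (a : pfun n).
Implicit Types u v : 'I_n.

Definition all_fixed := [forall v, periodic a v ==> (a v == Some v)].
Definition all_odd := [forall v, periodic a v ==> odd (period a v)].

Lemma iter_pmap_None m : iter m (pmap_of a) None = None.
Proof. by elim: m => //= m ->. Qed.

Lemma periodic_dom v : periodic a v -> exists u, a v = Some u.
Proof.
case/periodicP=> -[//|m] _; rewrite iterSr /=.
by case: (a v) => [u|]; [exists u | rewrite iter_pmap_None].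
Qed.

Lemma periodic_next u v : periodic a v -> a v = Some u -> periodic a u.
Proof.
move=> /periodicP[m m0 E] avu; apply/periodicP; exists m => //.
have hv : pmap_of a (Some v) = Some u by [].
by rewrite -hv -iterSr iterS E.
Qed.

Lemma iter_period u m q : iter m (pmap_of a) (Some u) = Some u ->
  iter (q * m) (pmap_of a) (Some u) = Some u.
Proof. by move=> E; elim: q => [//|q IH]; rewrite mulSn iterD IH. Qed.

(** Equal images make all positive iterates agree, and the product of a return time of [u] and one
    of [v] returns both points to themselves. *)
Lemma periodic_inj u v :
  periodic a u -> periodic a v -> a u = a v -> u = v.
Proof.
move=> /periodicP[p p0 Ep] /periodicP[q q0 Eq] uv.
have uvh : pmap_of a (Some u) = pmap_of a (Some v) by [].
apply: Some_inj; rewrite -(iter_period q Ep) -(iter_period p Eq) mulnC.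
have : (0 < p * q)%N by rewrite muln_gt0 p0.
by case: (p * q)%N => // m _; rewrite !iterSr uvh.
Qed.

Lemma period_fixed v : a v = Some v -> period a v = 1%N.
Proof.
move=> av; apply/eqP; rewrite eqn_leq fingraph.order_gt0 andbT.
have v_per : periodic a v by apply/periodicP; exists 1%N.
by have [_ _] := periodP v_per; apply.
Qed.

Lemma all_fixed_odd : all_fixed -> all_odd.
Proof.
move=> /forallP fixa; apply/forallP=> v; apply/implyP=> v_per.
by rewrite period_fixed //; apply/eqP/(implyP (fixa v)).
Qed.

(** The period of [u] is at most 2, hence 1 by oddness. This is what keeps the edges chosen for
    distinct columns distinct. *)
Lemma all_odd_no_2cycle u v :
  all_odd -> a u = Some v -> a v = Some u -> u = v.
Proof.
move=> /forallP odda uv vu.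
have E : iter 2 (pmap_of a) (Some u) = Some u by rewrite /= uv /= vu.
have u_per : periodic a u by apply/periodicP; exists 2%N.
have [p0 Ep min] := periodP u_per; have := min 2%N isT E.
move: (implyP (odda u) u_per) p0 Ep {min}.
by case: (period a u) => [|[|[|]]] //= _ _; rewrite uv => -[].
Qed.

(** * The permutation of an enumeration of the domain induced on periodic points *)

Variables (I : finType) (g : I -> 'I_n) (w : I -> 'I_n).
Hypothesis g_inj : injective g.
Hypothesis ag : forall i, a (g i) = Some (w i).
Hypothesis dom_g : forall v, a v != None -> exists i, v = g i.

Lemma periodic_img v : periodic a v -> exists i, v = g i.
Proof. by move=> /periodic_dom[u au]; apply: dom_g; rewrite au. Qed.

(** The partial function maps periodic points injectively to periodic points, all of which are
    enumerated by [g]; the identity elsewhere completes this to an injection of a finite type. *)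
Lemma periodic_perm_exists : exists c : {perm I}, forall i,
  if periodic a (g i) then g (c i) = w i else c i = i.
Proof.
(* The default [i] is never taken: for periodic [g i] the point [w i] is periodic, hence in the
   image of [g]. *)
pose c i := if periodic a (g i) then odflt i [pick j | g j == w i] else i.
have cP i : if periodic a (g i) then g (c i) = w i else c i = i.
  rewrite /c; case i_per: (periodic a (g i)) => //; case: pickP => [j /eqP //|].
  have [l wl] := periodic_img (periodic_next i_per (ag i)).
  by move/(_ l); rewrite wl eqxx.
have c_inj : injective c.
  move=> i j E; move: (cP i) (cP j); rewrite -E.
  case: ifP => i_per; case: ifP => j_per; last by move=> ->.
  - move=> Ei Ej; apply: g_inj; apply: periodic_inj => //.
    by rewrite !ag -Ei -Ej.
  - by move=> Ei Ej; move: j_per; rewrite -Ej Ei (periodic_next i_per).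
  - by move=> Ei Ej; move: i_per; rewrite -Ei Ej (periodic_next j_per).
by exists (perm c_inj) => i; rewrite permE; apply: cP.
Qed.

Variable c : {perm I}.
Hypothesis cP : forall i, if periodic a (g i) then g (c i) = w i else c i = i.

(** The [t]-orbit of a moved point consists of moved points, so there [t] follows [a]; it closes up
    after the order of [t], which makes the point periodic, and there [c] follows [a] as well. *)
Lemma valid_cycle (t : {perm I}) :
  (forall i, t i != i -> g (t i) = w i) ->
  forall i, t i = i \/ t i = c i.
Proof.
move=> tP i; case: (eqVneq (t i) i) => [|ti]; [by left | right].
have step m : t ((t ^+ m)%g i) != (t ^+ m)%g i.
  elim: m => [|m IH]; first by rewrite expg0 perm1.
  by rewrite expgSr permM; apply: contraNneq IH => /perm_inj/eqP.
have iterE m : iter m (pmap_of a) (Some (g i)) = Some (g ((t ^+ m)%g i)).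
  elim: m => [|m IH]; first by rewrite expg0 perm1.
  by rewrite iterS IH /= ag -tP // expgSr permM.
have i_per : periodic a (g i).
  apply/periodicP; exists #[t]%g; first exact: order_gt0.
  by rewrite iterE expg_order perm1.
by apply: g_inj; rewrite tP //; move: (cP i); rewrite i_per => ->.
Qed.

Lemma iter_cycle i m : periodic a (g i) ->
  iter m (pmap_of a) (Some (g i)) = Some (g ((c ^+ m)%g i)).
Proof.
move=> i_per.
suff [] : periodic a (g ((c ^+ m)%g i)) /\
  iter m (pmap_of a) (Some (g i)) = Some (g ((c ^+ m)%g i)) by [].
elim: m => [|m [per IH]]; first by rewrite expg0 perm1.
have := cP ((c ^+ m)%g i); rewrite per expgSr permM => ->; split.
  exact: periodic_next (ag _).
by rewrite iterS IH /= ag.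
Qed.

Lemma aorbit_cycle i : periodic a (g i) -> aorbit a (g i) = g @: porbit c i.
Proof.
move=> i_per; apply/setP=> v; rewrite inE; apply/idP/imsetP.
  move/iter_findex; rewrite iter_cycle // => -[<-].
  by exists ((c ^+ findex (pmap_of a) (Some (g i)) (Some v))%g i);
    rewrite ?mem_porbit.
by case=> j /porbitP[m ->] ->; rewrite -iter_cycle // fconnect_iter.
Qed.

Lemma period_cycle i : periodic a (g i) -> period a (g i) = #|porbit c i|.
Proof.
move=> i_per; rewrite -(card_imset _ g_inj) -aorbit_cycle //.
rewrite -(card_imset _ (@Some_inj _)) /period /fingraph.order.
apply: eq_card => -[v|].
  by apply/idP/imsetP => [hv | [x]]; [exists v; rewrite ?inE | rewrite inE => hx [->]].
(* [period] counts an orbit in [option 'I_n]; from a periodic point [None] is never reached. *)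
transitivity false; last by apply/esym/negbTE/imsetP => -[].
by apply/negP => /iter_findex; rewrite iter_cycle.
Qed.

Lemma moved_periodic i : i \in moved c -> periodic a (g i).
Proof. by rewrite inE; apply: contraR => /negbTE N; have := cP i; rewrite N => ->. Qed.

Lemma all_odd_cycles :
  all_odd = [forall B in nontrivial_cycles c, odd #|B|].
Proof.
apply/forallP/forall_inP => [odda B | oddc v].
  rewrite inE => /andP[/imsetP[i _ ->]]; rewrite card_porbit_gt1 => mi.
  have i_per := moved_periodic mi.
  by rewrite -period_cycle //; apply: (implyP (odda _)).
apply/implyP=> v_per; have [i vi] := periodic_img v_per; subst v.
rewrite period_cycle //; case: (ltnP 1 #|porbit c i|) => [gt1|le1].
  by apply: oddc; rewrite inE gt1 imset_f.
have /eqP -> // : #|porbit c i| == 1%N.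
by rewrite eqn_leq le1 lt0n card_porbit_neq0.
Qed.

Lemma all_fixed_cycles : all_fixed = (nontrivial_cycles c == set0).
Proof.
apply/forallP/eqP => [fixa | c0 v].
  apply/setP=> B; rewrite inE in_set0; apply/negP => /andP[/imsetP[i _ ->]].
  rewrite card_porbit_gt1 => mi; have i_per := moved_periodic mi.
  move: (implyP (fixa _) i_per) (cP i) mi; rewrite i_per ag => /eqP[->].
  by move=> /g_inj ci; rewrite inE ci eqxx.
apply/implyP=> v_per; have [i vi] := periodic_img v_per; subst v.
suff ci : c i = i by move: (cP i); rewrite v_per ag ci => <-.
apply/eqP/contraT => mi.
have : porbit c i \in nontrivial_cycles c.
  by rewrite inE imset_f // card_porbit_gt1 inE.
by rewrite c0 inE.
Qed.

(** Under [all_odd] the parity condition in [odlen] is automatic, and [g] carries the nontrivial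
    cycles of [c] bijectively to the orbits counted. *)
Lemma odlen_cycles : all_odd -> odlen a = #|nontrivial_cycles c|.
Proof.
rewrite all_odd_cycles => /forall_inP oddc.
rewrite -(card_imset _ (imset_inj g_inj)); apply: eq_card => O.
apply/imsetP/imsetP => [[v] | [B BN ->]].
  rewrite inE => /and3P[v_per _ gt1] ->.
  have [i vi] := periodic_img v_per; subst v.
  exists (porbit c i); last exact: aorbit_cycle.
  by rewrite inE -period_cycle // gt1 imset_f.
move: (BN); rewrite inE => /andP[/imsetP[i _ Bi]]; subst B => gt1.
have i_per : periodic a (g i) by rewrite moved_periodic // -card_porbit_gt1.
exists (g i); last by rewrite aorbit_cycle.
by rewrite inE i_per period_cycle // gt1 oddc.
Qed.

End Periodic.

(** * The minor attached to an animation *)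

Definition edge n (u v : 'I_n) : 'I_n * 'I_n :=
  if (u <= v)%N then (u, v) else (v, u).

Lemma det_row_perm_scale (R : comNzRingType) k (A M : 'M[R]_k) p d :
  row_perm p A = diag_mx d *m M ->
  \det A = (-1) ^+ p * (\prod_i d 0 i) * \det M.
Proof.
move=> /(congr1 (fun B => (-1) ^+ p * \det B)).
rewrite row_permE !det_mulmx det_perm det_diag mulrA -signr_addb addbb mul1r.
by rewrite -mulrA.
Qed.

(* As in [incidence], [s = true] stands for C^- and [s = false] for C^+. *)
Definition admissible (s : bool) n (a : pfun n) : bool :=
  if s then all_fixed a else all_odd a.

Definition exponent2 (s : bool) n (a : pfun n) : nat :=
  if s then 0 else odlen a.

Section Minor.
Variables (n k : nat) (a : pfun n) (g w : 'I_k -> 'I_n).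
Hypothesis g_inj : injective g.
Hypothesis ag : forall i, a (g i) = Some (w i).
Hypothesis dom_g : forall v, a v != None -> exists i, v = g i.

Lemma mon_rows (R : comNzRingType) : mon R a = \prod_i 'X_(w i).
Proof.
rewrite /mon (bigID (mem (g @: setT))) /= [X in _ * X]big1 ?mulr1.
  rewrite big_imset /=; last by move=> i j _ _; apply: g_inj.
  by apply: eq_big => [i|i _]; rewrite ?inE ?ag.
move=> v; case av: (a v) => // /negP[].
by have [|i ->] := @dom_g v; rewrite ?av ?imset_f.
Qed.

Lemma det_animation (R : comNzRingType) (z : {mpoly R[n]}) (c : 'S_k) :
  (forall i, if periodic a (g i) then g (c i) = w i else c i = i) ->
  \det (\matrix_(i < k, j < k)
     (if j == i then 'X_(w i) else if g j == w i then z * 'X_(g i) else 0)) =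
  \prod_(B in nontrivial_cycles c) (1 - (- z) ^+ #|B|) * mon R a.
Proof.
move=> cP; rewrite -sum_sub_cycles mulr_suml /determinant big_mkcond /=.
rewrite [RHS]big_mkcond /=; apply: eq_bigr => t _; rewrite -mulrA.
case: ifPn => [/forallP tc | ].
  congr (_ * _).
  have tw i : t i != i -> g (t i) = w i.
    case/orP: (tc i) => /eqP -> ; first by rewrite eqxx.
    by move=> ci; move: (cP i); case: ifP => // _ ci'; rewrite ci' eqxx in ci.
  transitivity (\prod_i ((if t i != i then z else 1) * 
                         'X_(if t i != i then g i else w i)) : {mpoly R[n]}).
    apply: eq_bigr => i _; rewrite mxE; case: eqVneq => [_|ti] /=.
      by rewrite mul1r.
    by rewrite tw // eqxx.
  rewrite big_split /=; congr (_ * _).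
    by rewrite -big_mkcond prodr_const /=; congr (_ ^+ _); apply: eq_card => i; rewrite !inE.
  rewrite mon_rows (bigID (mem (moved t))) [RHS](bigID (mem (moved t))) /=.
  congr (_ * _); last by apply: eq_bigr => i; rewrite inE => /negbTE ->.
  (* [t] permutes its moved points, so replacing [i] by [t i] turns [g i] into [g (t i)], which is
     [w i]. *)
  rewrite (reindex_inj (@perm_inj _ t)) /=; apply: eq_big => [i|i].
    by rewrite !inE (inj_eq perm_inj).
  rewrite !inE => ti; rewrite ti tw //; move: ti; by rewrite (inj_eq perm_inj).
(* For the remaining [t] some factor of the term is a zero entry; otherwise [valid_cycle] would put
   [t] among the permutations already treated. *)
move=> tN; suff [i] : exists i, ~~ ((t i == i) || (g (t i) == w i)).
  rewrite negb_or => /andP[/negbTE ti /negbTE tw].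
  by rewrite (bigD1 i) //= mxE ti tw mul0r mulr0.
apply/existsP; rewrite -negb_forall; apply: contra tN => /forallP tw.
apply/forallP=> i; apply/orP.
have tw' j : t j != j -> g (t j) = w j.
  by move=> tj; case/orP: (tw j) tj => /eqP -> //; rewrite eqxx.
by case: (valid_cycle g_inj ag cP tw' i) => ->; [left | right].
Qed.

Lemma minor_animation (s : bool) (adj : rel 'I_n) (f : 'I_k -> 'I_#|edges adj|)
    (p : 'S_k) :
  (forall i, enum_val (f (p i)) = edge (g i) (w i)) ->
  exists e : bool, \det (mxsub f g (incidence s adj)) =
    (-1) ^+ e * ((if admissible s a then 2 ^+ exponent2 s a else 0) * mon int a).
Proof.
move=> fp; have [c cP] := periodic_perm_exists g_inj ag dom_g.
pose z : {mpoly int[n]} := (-1) ^+ s.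
have zz : z * z = 1 by rewrite /z -signr_addb addbb.
have := det_animation z cP; set M := \matrix_(i, j) _ => detM.
(* When [g i] is the smaller end of its edge, [incidence] has the factor [z] in column [g i] instead
   of [w i]; since [z * z = 1], scaling the row by [z] corrects this. *)
have EM : row_perm p (mxsub f g (incidence s adj)) =
    diag_mx (\row_i (if (g i < w i)%N then z else 1)) *m M.
  apply/matrixP=> i j; rewrite mul_diag_mx !mxE fp /edge -(inj_eq g_inj j i).
  case: ltngtP => [lt_gw|lt_wg|/val_inj ->] /=.
  - case: (eqVneq (g j) (w i)) => [->|_]; last by case: ifP; rewrite ?mulr0.
    by rewrite [w i == _]gtn_eqF // mulrA zz mul1r.
  - by rewrite mul1r.
  - by rewrite mul1r; case: ifP.
have [e eE] : exists e : bool,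
    \prod_i (if (g i < w i)%N then z else 1) = (-1) ^+ e :> {mpoly int[n]}.
  elim/big_ind: _ => [|x y [b ->] [d ->]|i _]; first by exists false.
    by exists (b (+) d); rewrite signr_addb.
  by case: ifP; [exists s | exists false].
have eE' : \prod_i (\row_i (if (g i < w i)%N then z else 1)) 0 i = (-1) ^+ e.
  by rewrite -eE; apply: eq_bigr => i _; rewrite mxE.
exists (p (+) e).
rewrite (det_row_perm_scale EM) eE' -signr_addb detM; congr (_ * (_ * _)).
rewrite /admissible /exponent2 (all_odd_cycles g_inj ag dom_g cP).
rewrite (all_fixed_cycles g_inj ag dom_g cP).
rewrite /z; case: (s) => /=.
  case: (eqVneq (nontrivial_cycles c)) => [->|/set0Pn[B BN]]; first by rewrite big_set0.
  by rewrite (bigD1 B) //= expr1 opprK expr1n subrr mul0r.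
rewrite expr0; case: ifPn => [oddc | /forall_inPn[B BN evenB]].
  rewrite (odlen_cycles g_inj ag dom_g cP) ?(all_odd_cycles g_inj ag dom_g cP) //.
  rewrite -prodr_const; apply: eq_bigr => B BN.
  by rewrite -signr_odd (forall_inP oddc) // expr1 opprK.
by rewrite (bigD1 B) //= -signr_odd (negbTE evenB) subrr mul0r.
Qed.

End Minor.

(** * Correspondence between nonzero minors and animations *)

Lemma homo_ltn_inj k m (f : 'I_k -> 'I_m) :
  {homo f : i j / (i < j)%N} -> injective f.
Proof.
move=> f_homo i j E; apply/val_inj; case: (ltngtP i j) => // /f_homo;
  by rewrite E ltnn.
Qed.

(** Supplies the increasing selections of rows and columns that [is_minor] requires. *)
Lemma increasing_enum k m (D : {set 'I_m}) : #|D| = k ->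
  exists2 f : 'I_k -> 'I_m, {homo f : i j / (i < j)%N} &
    forall x, (x \in D) = (x \in codom f).
Proof.
move=> <-; exists (@Order.EnumVal.enum_val _ _ (mem D)) => [i j lt_ij|x].
  have := leW_mono (@Order.EnumVal.le_enum_val _ _ (@le_total _ _) (mem D)) i j.
  by rewrite !ltEord lt_ij.
apply/idP/codomP => [xD | [i ->]]; last exact: Order.EnumVal.enum_valP.
by exists (Order.EnumVal.enum_rank_in xD x); rewrite Order.EnumVal.enum_rankK_in.
Qed.

Section MinorsAnimations.
Variables (s : bool) (n : nat) (adj : rel 'I_n).
Hypothesis adj_sym : ssrbool.symmetric adj.
Variable k : nat.
Implicit Types (a : pfun n) (u v : 'I_n).

Lemma edge_in u v : adj u v -> edge u v \in edges adj.
Proof.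
rewrite /edge inE; case: (leqP u v) => [-> //|/ltnW vu] /=.
by rewrite vu adj_sym.
Qed.

Lemma edge_eq u v u' v' :
  edge u v = edge u' v' -> (u = u' /\ v = v') \/ (u = v' /\ v = u').
Proof.
by rewrite /edge; case: ifP => _; case: ifP => _ [-> ->]; [left|right|right|left].
Qed.

(** The columns are the domain of [a] and the rows the edges joining [v] to its image. Two columns
    could share an edge only by forming a 2-cycle, which odd periods exclude, so there are exactly
    [k] rows. *)
Lemma minor_of_animation a :
  animation adj a -> #|dom a| = k -> admissible s a ->
  exists (f : 'I_k -> 'I_#|edges adj|) (g : 'I_k -> 'I_n),
    [/\ {homo f : i j / (i < j)%N}, {homo g : i j / (i < j)%N} &
    exists e : bool, \det (mxsub f g (incidence s adj)) =
      (-1) ^+ e * (2 ^+ exponent2 s a * mon int a)].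
Proof.
move=> /forallP anim cD adm.
have odda : all_odd a.
  by move: adm; rewrite /admissible; case: (s) => // /all_fixed_odd.
have [g g_homo gD] := increasing_enum cD.
have g_inj := homo_ltn_inj g_homo.
pose w i := odflt (g i) (a (g i)).
have ag i : a (g i) = Some (w i).
  have : g i \in dom a by rewrite gD codom_f.
  by rewrite inE /w; case: (a (g i)).
have dom_g v : a v != None -> exists i, v = g i.
  by move=> av; apply/codomP; rewrite -gD inE.
have e_in i : edge (g i) (w i) \in edges adj.
  by apply: edge_in; have := anim (g i); rewrite ag adj_sym.
pose r i := enum_rank_in (e_in i) (edge (g i) (w i)).
have rK i : enum_val (r i) = edge (g i) (w i) by rewrite /r enum_rankK_in.
have r_inj : injective r.
  move=> i j /(congr1 enum_val); rewrite !rK => /edge_eq[[/g_inj //]|[gw wg]].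
  by apply/g_inj/(all_odd_no_2cycle odda); rewrite ag ?gw ?wg.
have [|f f_homo fF] := @increasing_enum k _ [set r i | i in 'I_k].
  by rewrite card_imset ?card_ord.
have /fin_all_exists[p0 p0E] i : exists j, f j = r i.
  have /codomP[j ->] : r i \in codom f by rewrite -fF imset_f.
  by exists j.
have p0_inj : injective p0 by move=> i j E; apply: r_inj; rewrite -!p0E E.
(* [p0] sends a column to the position of its edge in the increasing list of rows, as
   [minor_animation] demands. *)
exists f, g; split=> //.
have [|e ->] := @minor_animation _ _ _ _ _ g_inj ag dom_g s adj f (perm p0_inj).
  by move=> i; rewrite permE p0E.
by exists e; rewrite adm.
Qed.

(** The animation is read off a nonvanishing Leibniz term; it is admissible because
    [minor_animation] would otherwise make the minor zero. *)
Lemma animation_of_minor (f : 'I_k -> 'I_#|edges adj|) (g : 'I_k -> 'I_n) :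
  injective g -> \det (mxsub f g (incidence s adj)) != 0 ->
  exists a, [/\ animation adj a, #|dom a| = k, admissible s a &
    exists e : bool, \det (mxsub f g (incidence s adj)) =
      (-1) ^+ e * (2 ^+ exponent2 s a * mon int a)].
Proof.
move=> g_inj nz.
have : exists t : 'S_k, \prod_i mxsub f g (incidence s adj) i (t i) != 0.
  apply/existsP; rewrite -negb_forall; apply: contra nz => /forallP z.
  by apply/eqP/big1 => t _; rewrite (eqP (z t)) mulr0.
case=> t /prodf_neq0 nzt.
(* The entry of column [g i] in its matched row is nonzero, so [g i] is an end of that edge, and [w]
   is the other end, or [g i] itself for a loop. *)
have ex i : exists w, [/\ enum_val (f ((t^-1)%g i)) = edge (g i) w & adj w (g i)].
  have := nzt ((t^-1)%g i) isT; rewrite !mxE permKV.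
  have := enum_valP (f ((t^-1)%g i)).
  case: (enum_val _) => u v; rewrite inE /= => /andP[uv adj_uv].
  case: (eqVneq (g i) v) => [-> _|_].
    exists u; rewrite adj_uv /edge; split=> //.
    by case: leqP => // vu; rewrite (val_inj (anti_leq (introT andP (conj uv vu)))).
  case: (eqVneq (g i) u) => [-> _|]; last by rewrite eqxx.
  by exists v; rewrite adj_sym adj_uv /edge uv.
have [w wP] := fin_all_exists ex.
pose a : pfun n := [ffun v => omap w [pick i | g i == v]].
have ag i : a (g i) = Some (w i).
  rewrite ffunE; case: pickP => [j /eqP/g_inj -> //|/(_ i)]; by rewrite eqxx.
have dom_g v : a v != None -> exists i, v = g i.
  by rewrite ffunE; case: pickP => // i /eqP <- _; exists i.
have [i|e E] := @minor_animation _ _ _ _ _ g_inj ag dom_g s adj f (t^-1)%g.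
  by have [] := wP i.
exists a; split.
- apply/forallP=> v; case av: (a v) => [u|//].
  have [|i vi] := dom_g v; first by rewrite av.
  by move: av; rewrite vi ag => -[<-]; have [] := wP i.
- rewrite (_ : dom a = g @: setT) ?card_imset ?cardsT ?card_ord //.
  apply/setP=> v; rewrite inE; apply/idP/imsetP => [/dom_g[i ->]|[i _ ->]].
    by exists i.
  by rewrite ag.
- by apply: contraNT nz => /negbTE N; rewrite E N mul0r mulr0.
- exists e; rewrite E; case: ifP => // N; move: nz; by rewrite E N mul0r mulr0 eqxx.
Qed.

Lemma mon_neq0 a : mon int a != 0.
Proof.
apply/prodf_neq0 => v _; case: (a v) => [u|]; last exact: oner_neq0.
by rewrite -msupp_eq0 msuppX.
Qed.

(** [minor_animation] leaves the sign undetermined, so both sides are closed under negation. *)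
Lemma minor_animationP (p : {mpoly int[n]}) :
  (p != 0 /\ (is_minor (incidence s adj) k p \/
              is_minor (incidence s adj) k (- p))) <->
  exists a, [/\ animation adj a, #|dom a| = k, admissible s a &
    p = 2 ^+ exponent2 s a * mon int a \/ p = - (2 ^+ exponent2 s a * mon int a)].
Proof.
split=> [[p0 pm]|[a [anim cD adm pE]]].
  have [q [q0 qm pq]] : exists q,
      [/\ q != 0, is_minor (incidence s adj) k q & p = q \/ p = - q].
    by case: pm => pm; [exists p | exists (- p)]; rewrite ?oppr_eq0 ?opprK; split; auto.
  case: qm => f [g [_ /homo_ltn_inj g_inj Eq]].
  have [|a [anim cD adm [e Ea]]] := animation_of_minor g_inj (f := f); first by rewrite -Eq.
  exists a; split=> //; move: pq; rewrite Eq Ea.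
  by case: e {Ea}; rewrite ?expr1 ?mulN1r ?expr0 ?mul1r ?opprK; case; auto.
have [f [g [fh gh [e E]]]] := minor_of_animation anim cD adm.
split.
  have nz : 2 ^+ exponent2 s a * mon int a != 0.
    by rewrite mulf_neq0 ?mon_neq0 // expf_neq0 // -mpolyC_nat mpolyC_eq0.
  by case: pE => ->; rewrite ?oppr_eq0.
have [] : \det (mxsub f g (incidence s adj)) = p \/
          \det (mxsub f g (incidence s adj)) = - p.
- rewrite E; case: e {E}; case: pE => ->;
    rewrite ?expr1 ?mulN1r ?expr0 ?mul1r ?opprK; auto.
- by left; exists f, g.
- by right; exists f, g.
Qed.

End MinorsAnimations.

(** * Generated ideals *)

Section Ideal.
Variables (R : comNzRingType) (S : R -> Prop).

Lemma ideal_gen0 : ideal_gen S 0.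
Proof.
by exists 0, (fun=> 0), (fun=> 0); split; [case | rewrite big_ord0].
Qed.

Lemma ideal_genD x y : ideal_gen S x -> ideal_gen S y -> ideal_gen S (x + y).
Proof.
move=> [m1 [a1 [g1 [S1 ->]]]] [m2 [a2 [g2 [S2 ->]]]].
exists (m1 + m2)%N, (fun i => match split i with inl j => a1 j | inr j => a2 j end),
  (fun i => match split i with inl j => g1 j | inr j => g2 j end).
split=> [i|]; first by case: (split i).
rewrite big_split_ord /=; congr (_ + _); apply: eq_bigr => i _.
  by rewrite (unsplitK (inl i)).
by rewrite (unsplitK (inr i)).
Qed.

Lemma ideal_genMl b x : ideal_gen S x -> ideal_gen S (b * x).
Proof.
move=> [m [a [g [Sg ->]]]]; exists m, (fun i => b * a i), g; split=> //.
by rewrite mulr_sumr; apply: eq_bigr => i _; rewrite mulrA.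
Qed.

Lemma ideal_gen_mem x : S x -> ideal_gen S x.
Proof.
move=> Sx; exists 1%N, (fun=> 1), (fun=> x); split=> //.
by rewrite big_ord1 mul1r.
Qed.

Lemma ideal_gen_signed_mem x : S x \/ S (- x) -> ideal_gen S x.
Proof.
case=> [|Sx]; first exact: ideal_gen_mem.
by rewrite -[x]opprK -mulN1r; apply/ideal_genMl/ideal_gen_mem.
Qed.

Lemma ideal_gen_sum m (a g : 'I_m -> R) :
  (forall i, ideal_gen S (g i)) -> ideal_gen S (\sum_(i < m) a i * g i).
Proof.
move=> Sg; elim/big_ind: _ => [||i _].
- exact: ideal_gen0.
- exact: ideal_genD.
- exact: ideal_genMl.
Qed.

(** Reduces each inclusion of ideals below to a check on generators. *)
Lemma ideal_gen_sub (S' : R -> Prop) :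
  (forall x, S' x -> ideal_gen S x) -> forall x, ideal_gen S' x -> ideal_gen S x.
Proof. by move=> sub x [m [a [g [Sg ->]]]]; apply: ideal_gen_sum => i; apply: sub. Qed.

End Ideal.

(** * Comparison of minor ideals with monomial ideals *)

Lemma half_in : (2^-1 : rat) \in half_int.
Proof. by apply/half_intP; exists 1%N; rewrite expr1 mulVf ?rpred1. Qed.

Definition half : Zhalf := MkZhalf half_in.

Lemma half2 : half * 2 = 1.
Proof. by apply: val_inj; rewrite rmorphM rmorph_nat rmorph1 /= mulVf. Qed.

Lemma map_mon (R : comNzRingType) n (a : pfun n) :
  map_mpoly intr (mon int a) = mon R a.
Proof.
rewrite /mon rmorph_prod; apply: eq_bigr => v _.
by case: (a v) => [u|] /=; rewrite ?rmorph1 ?map_mpolyX.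
Qed.

Section Ideals.
Variables (n : nat) (adj : rel 'I_n).
Hypothesis adj_sym : ssrbool.symmetric adj.
Variable k : nat.

Lemma FixP a : (a \in Fix adj k) <->
  [/\ animation adj a, #|dom a| = k & admissible true a].
Proof. by rewrite inE; split=> [/and3P[? /eqP]|[? /eqP ? ?]] //; apply/and3P. Qed.

Lemma OddP a : (a \in Odd adj k) <->
  [/\ animation adj a, #|dom a| = k & admissible false a].
Proof. by rewrite inE; split=> [/and3P[? /eqP]|[? /eqP ? ?]] //; apply/and3P. Qed.

Lemma minor_FixP (p : {mpoly int[n]}) :
  (p != 0 /\ (is_minor (Cminus adj) k p \/ is_minor (Cminus adj) k (- p)))
  <-> exists2 a, a \in Fix adj k & p = mon int a \/ p = - mon int a.
Proof.
apply: iff_trans (minor_animationP true adj_sym k p) _.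
split=> [[a [anim cD adm]]|[a /FixP[anim cD adm] pE]].
  by rewrite expr0 mul1r => pE; exists a => //; apply/FixP.
by exists a; rewrite expr0 mul1r.
Qed.

Lemma minor_OddP (p : {mpoly int[n]}) :
  (p != 0 /\ (is_minor (Cplus adj) k p \/ is_minor (Cplus adj) k (- p)))
  <-> exists2 a, a \in Odd adj k &
        p = 2 ^+ odlen a *: mon int a \/ p = - (2 ^+ odlen a *: mon int a).
Proof.
have scale a : 2 ^+ odlen a *: mon int a = 2 ^+ odlen a * mon int a.
  by rewrite -mul_mpolyC rmorphXn rmorph_nat.
apply: iff_trans (minor_animationP false adj_sym k p) _.
split=> [[a [anim cD adm pE]]|[a /OddP[anim cD adm]]].
  by exists a; rewrite ?scale //; apply/OddP.
by rewrite scale => pE; exists a.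
Qed.

Lemma Iminus_Fix (p : {mpoly int[n]}) :
  Iminus adj k p <->
  ideal_gen (fun q => exists2 a, a \in Fix adj k & q = mon int a) p.
Proof.
split; apply: ideal_gen_sub => q.
  (* Vanishing minors are also generators, and [minor_FixP] covers only the nonzero ones. *)
  case: (eqVneq q 0) => [-> _|q0 qm]; first exact: ideal_gen0.
  have [a aF qE] := (minor_FixP q).1 (conj q0 (or_introl qm)).
  apply: ideal_gen_signed_mem.
  by case: qE => ->; [left | right]; exists a; rewrite ?opprK.
case=> a aF qE; apply: ideal_gen_signed_mem.
by apply: (proj2 ((minor_FixP q).2 _)); exists a; auto.
Qed.

(** Over [Zhalf] the power of 2 in a minor is a unit, so the minor and its monomial generate the
    same ideal. *)
Lemma half_Iplus_Odd (p : {mpoly Zhalf[n]}) :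
  half_Iplus adj k p <->
  ideal_gen (fun q => exists2 a, a \in Odd adj k & q = mon Zhalf a) p.
Proof.
have map_scale a :
    map_mpoly intr (2 ^+ odlen a *: mon int a) = 2 ^+ odlen a * mon Zhalf a.
  by rewrite -mul_mpolyC !rmorphM !rmorphXn !rmorph_nat /= map_mon.
split; apply: ideal_gen_sub => q.
  (* A generator here is the image of an arbitrary element of [Iplus], so it is first expanded as a
     combination of minors. *)
  case=> x [m [b [h [hm ->]]]] ->; rewrite rmorph_sum /=.
  under eq_bigr do rewrite rmorphM /=.
  apply: ideal_gen_sum => i.
  case: (eqVneq (h i) 0) => [->|h0]; first by rewrite rmorph0; exact: ideal_gen0.
  have [a aO hE] := (minor_OddP (h i)).1 (conj h0 (or_introl (hm i))).
  have aI : ideal_gen (fun q => exists2 a, a \in Odd adj k & q = mon Zhalf a)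
      (2 ^+ odlen a * mon Zhalf a).
    by apply/ideal_genMl/ideal_gen_mem; exists a.
  case: hE => ->; rewrite ?rmorphN /= map_scale //.
  by rewrite -mulN1r; apply: ideal_genMl.
case=> a aO ->.
have -> : mon Zhalf a =
    (half ^+ odlen a)%:MP * map_mpoly intr (2 ^+ odlen a *: mon int a).
  rewrite map_scale mulrA -[2]mpolyC_nat -rmorphXn -rmorphM -exprMn.
  by rewrite half2 expr1n rmorph1 mul1r.
apply/ideal_genMl/ideal_gen_mem; eexists; last by [].
apply: ideal_gen_signed_mem.
by apply: (proj2 ((minor_OddP _).2 _)); exists a; auto.
Qed.

End Ideals.

Theorem theorem6p1 (n : nat) (adj : rel 'I_n) (adj_sym : ssrbool.symmetric adj)
    (k : nat) :
  ((forall p : {mpoly int[n]},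
      Iminus adj k p <->
      ideal_gen (fun q => exists2 a, a \in Fix adj k & q = mon int a) p) /\
   (forall p : {mpoly int[n]},
      (p != 0 /\ (is_minor (Cminus adj) k p \/ is_minor (Cminus adj) k (- p)))
      <-> exists2 a, a \in Fix adj k & p = mon int a \/ p = - mon int a)) /\
  ((forall p : {mpoly Zhalf[n]},
      half_Iplus adj k p <->
      ideal_gen (fun q => exists2 a, a \in Odd adj k & q = mon Zhalf a) p) /\
   (forall p : {mpoly int[n]},
      (p != 0 /\ (is_minor (Cplus adj) k p \/ is_minor (Cplus adj) k (- p)))
      <-> exists2 a, a \in Odd adj k &
          p = 2 ^+ odlen a *: mon int a \/ p = - (2 ^+ odlen a *: mon int a))).
Proof.
split; split.
- exact: Iminus_Fix.
- exact: minor_FixP.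
- exact: half_Iplus_Odd.
- exact: minor_OddP.
Qed.
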